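(* Fix a policy $\pi$ and assume $T,T'>t_{\mathrm{mix}}+1$. Then the estimators $\widehat\rho^\pi$ and $\widehat Q^\pi$ generated by the multiple-trajectory method satisfy $$|\mathbb E[\widehat\rho^\pi]-\rho^\pi|\le\bar c\cdot\big(\tfrac12\big)^{\lfloor T/t_{\mathrm{mix}}\rfloor}$$ and $$\|\mathbb E[\widehat Q^\pi]-\bar Q^\pi\|_\infty\le\bar c\,(T'+1)\cdot\big(\tfrac12\big)^{\lfloor T/t_{\mathrm{mix}}\rfloor}+2\bar c\cdot t_{\mathrm{mix}}\cdot\big(\tfrac12\big)^{\lfloor T'/t_{\mathrm{mix}}\rfloor},$$ where $\bar c:=\max_{s\in\mathcal S,a\in\mathcal A}|c(s,a)|$.
   Context: **Setting.** Finite MDP with state space $\mathcal S$, action space $\mathcal A$, transition kernel $\mathsf P(s'|s,a)$ and cost $c:\mathcal S\times\mathcal A\to\mathbb R$ (any regularizer of the fixed policy is absorbed in $c$). A policy $\pi$ assigns to each $s$ a distribution $\pi(\cdot|s)$ on $\mathcal A$; $P_\pi(s,s')=\sum_a\pi(a|s)\mathsf P(s'|s,a)$. Mixing assumption: every policy $\pi$ has a stationary distribution $\nu^\pi$ and $t_{\mathrm{mix}}:=\max_\pi\min\{t\ge1:\max_{q\in\Delta_{|\mathcal S|}}\|((P_\pi)^t)^\top q-\nu^\pi\|_1\le\frac12\}<\infty$. $\rho^\pi=\sum_{s,a}\nu^\pi(s)\pi(a|s)c(s,a)$ and $\bar Q^\pi(s,a)=\mathbb E_\pi[\sum_{t\ge0}(c(s_t,a_t)-\rho^\pi)\mid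 s_0=s,a_0=a]$. **Multiple-trajectory method (generative model).** Input: $T,T',N,N'\in\mathbb Z_+$ and $\pi$. For $i=1,\dots,N$: generate, independently, a trajectory $(s_0=s',a_0),(s_1,a_1),\dots,(s_T,a_T)$ following $\pi$ from an arbitrary state $s'$, and let $\rho^i=c(s_T,a_T)$. Set $\widehat\rho^\pi=\frac1N\sum_{i=1}^N\rho^i$. For $j=1,\dots,N'$ and every $(s,a)$: generate an independent trajectory $(s_0^j=s,a_0^j=a),(s_1^j,a_1^j),\dots,(s_{T'}^j,a_{T'}^j)$ following $\pi$, and let $\bar Q^j(s,a)=\sum_{t=0}^{T'}(c(s_t^j,a_t^j)-\widehat\rho^\pi)$. Output $\widehat\rho^\pi$ and $\widehat Q^\pi(s,a)=\frac1{N'}\sum_{j=1}^{N'}\bar Q^j(s,a)$. Expectations are over all samples. *)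

(* Defs.v *)
From HB Require Import structures.
From mathcomp Require Import all_boot all_order all_algebra.
From mathcomp Require Import all_classical all_reals all_analysis.

Set Implicit Arguments.
Unset Strict Implicit.
Unset Printing Implicit Defensive.

Import Order.TTheory GRing.Theory Num.Theory.
Import numFieldNormedType.Exports.

Local Open Scope classical_set_scope.
Local Open Scope ring_scope.

Record distr (R : realType) (X : finType) := Distr {
  mass :> X -> R;
  mass_ge0 : forall x, 0 <= mass x;
  mass_sum1 : \sum_(x : X) mass x = 1 }.

Definition policy (R : realType) (S A : finType) := S -> distr R A.

Record mdp (R : realType) (S A : finType) := Mdp {
  trans : S -> A -> distr R S;
  cost : S -> A -> R }.

Section Mdp.
Context {R : realType} {S A : finType}.
Implicit Types (M : mdp R S A) (pi : policy R S A).

(* Indices run over the enumeration of S so that matrix powers are available. *)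
Definition policy_mx M pi : 'M[R]_#|S| :=
  \matrix_(i, j) \sum_(a : A)
     pi (enum_val i) a * trans M (enum_val i) a (enum_val j).

Definition distr_col (q : distr R S) : 'cV[R]_#|S| := \col_i q (enum_val i).

Definition norm1 (v : 'cV[R]_#|S|) : R := \sum_i `|v i 0|.

Definition stationary M pi (nu : distr R S) : Prop :=
  (policy_mx M pi)^T *m distr_col nu = distr_col nu.

Definition mixing_dist M pi (nu : distr R S) (t : nat) : \bar R :=
  ereal_sup [set (norm1 ((policy_mx M pi ^+ t)^T *m distr_col q
                          - distr_col nu))%:E | q in [set: distr R S]].

Definition mixed M pi (nu : distr R S) (t : nat) : Prop :=
  (1 <= t)%N /\ (mixing_dist M pi nu t <= (2^-1)%:E)%E.

Definition is_policy_tmix M pi (nu : distr R S) (t : nat) : Prop :=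
  mixed M pi nu t /\ forall u, mixed M pi nu u -> (t <= u)%N.

(* t is the maximum over all policies pi of the minimal mixing time of pi:
   it is an upper bound and it is attained. Each minimum must exist, so that
   the existence of such a t : nat is the assumption t_mix < oo. *)
Definition is_tmix M (nu : policy R S A -> distr R S) (t : nat) : Prop :=
  (forall pi, exists2 u, is_policy_tmix M pi (nu pi) u & (u <= t)%N) /\
  (exists pi, is_policy_tmix M pi (nu pi) t).

Definition cost_at M (x : S * A) : R := cost M x.1 x.2.

Definition cost_bound M : R := \big[Num.max/0]_(x : S * A) `|cost_at M x|.

Definition avg_cost M pi (nu : distr R S) : R :=
  \sum_(s : S) \sum_(a : A) nu s * pi s a * cost M s a.

(* (s_0, a_0), ..., (s_T, a_T) *)
Definition traj (T : nat) : finType := {ffun 'I_T.+1 -> S * A}.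

(* widen_ord _ t and lift ord0 t are t and t + 1 seen in 'I_T.+1. *)
Definition path_prob M pi T (w : traj T) : R :=
  \prod_(t < T)
    (let x := w (widen_ord (leqnSn T) t) in
     let y := w (lift ord0 t) in
     trans M x.1 x.2 y.1 * pi y.1 y.2).

Definition traj_prob_from_state M pi T (s : S) (w : traj T) : R :=
  ((w ord0).1 == s)%:R * pi s (w ord0).2 * path_prob M pi w.

Definition traj_prob_from_pair M pi T (s : S) (a : A) (w : traj T) : R :=
  (w ord0 == (s, a))%:R * path_prob M pi w.

Definition truncated_Q M pi (rho : R) (s : S) (a : A) (n : nat) : R :=
  \sum_(w : traj n) traj_prob_from_pair M pi s a w *
     \sum_(t < n.+1) (cost_at M (w t) - rho).

(* The pathwise series sum_t (c(s_t, a_t) - rho) diverges in general; its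
   expectation is, as usual, the limit of the finite-horizon expectations. *)
Definition bias_Q M pi (nu : distr R S) (s : S) (a : A) : R :=
  limn (truncated_Q M pi (avg_cost M pi nu) s a).

Section Estimators.
Context {d : measure_display} {Omega : measurableType d}.
Variables (M : mdp R S A) (T T' N N' : nat).
Variable X : 'I_N -> Omega -> traj T.
Variable Y : 'I_N' -> S -> A -> Omega -> traj T'.

(* The first N trajectories start in the states start i, the others in the
   pairs (s, a), and all of them are mutually independent: the joint law is the
   product of the individual trajectory laws. *)
Definition generated_samples (pi : policy R S A) (P : probability Omega R)
    (start : 'I_N -> S) : Prop :=
  [/\ forall i x, measurable (X i @^-1` [set x]),
      forall j s a y, measurable (Y j s a @^-1` [set y]) &
      forall (x : 'I_N -> traj T) (y : 'I_N' -> S -> A -> traj T'),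
        P [set w | (forall i, X i w = x i) /\
                   (forall j s a, Y j s a w = y j s a)] =
        ((\prod_(i < N) traj_prob_from_state M pi (start i) (x i)) *
         (\prod_(j < N') \prod_(s : S) \prod_(a : A)
            traj_prob_from_pair M pi s a (y j s a)))%:E].

Definition rho_hat (w : Omega) : R :=
  N%:R^-1 * \sum_(i < N) cost_at M (X i w ord_max).

Definition Q_sample (j : 'I_N') (s : S) (a : A) (w : Omega) : R :=
  \sum_(t < T'.+1) (cost_at M (Y j s a w t) - rho_hat w).

Definition Q_hat (s : S) (a : A) (w : Omega) : R :=
  N'%:R^-1 * \sum_(j < N') Q_sample j s a w.

End Estimators.

Definition norm_sup (f : S -> A -> \bar R) : \bar R :=
  \big[maxe/0%E]_(x : S * A) `|f x.1 x.2|%E.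

End Mdp.

Arguments traj : clear implicits.

(* Main.v *)
(* The expected cost at time t of a chain started from the state law q is
   q P_pi^t c_pi. As P_pi^T is an l1 contraction and its t_mix-th power maps
   every difference of distributions to one of half the l1 norm, this cost is
   within c_bar 2^-(t %/ t_mix) of rho^pi; averaging over the first batch of
   trajectories bounds the bias of rho_hat. Independence is irrelevant for the
   means: E[Q_hat] is the truncated bias function at level E[rho_hat], and
   replacing E[rho_hat] by rho^pi costs T' + 1 times the first error. The
   remaining error is the tail of the series defining the bias function, whose
   terms are shifted by one because the first action is prescribed; it is
   summed in blocks of length t_mix. *)
Require Import Defs.
From mathcomp Require Import all_boot all_order all_algebra.
From mathcomp Require Import all_classical all_reals all_analysis.
From mathcomp Require Import ring lra.

Set Implicit Arguments.
Unset Strict Implicit.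
Unset Printing Implicit Defensive.

Import Order.TTheory GRing.Theory Num.Theory.
Import numFieldNormedType.Exports.

Local Open Scope classical_set_scope.
Local Open Scope ring_scope.

(** * Finite sums, and a geometric sum constant on blocks *)

Lemma sum_enum_val (V : nmodType) (I : finType) (F : I -> V) :
  \sum_(i < #|I|) F (enum_val i) = \sum_x F x.
Proof. by rewrite -big_enum_val. Qed.

Lemma sum_eqM (R : pzSemiRingType) (I : finType) (x : I) (F : I -> R) :
  \sum_y (y == x)%:R * F y = F x.
Proof.
rewrite (bigD1 x)//= eqxx mul1r big1 ?addr0// => y /negbTE ->.
by rewrite mul0r.
Qed.

(* phi r = (2 tau - r %% tau) 2^-(r %/ tau) satisfies
   phi r - phi r.+1 = 2^-(r %/ tau), so the sum telescopes. *)
Lemma sum_half_div_le (R : realFieldType) (tau m n : nat) :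
  (0 < tau)%N -> (m <= n)%N ->
  \sum_(m <= r < n) (2^-1 : R) ^+ (r %/ tau)
    <= 2 * tau%:R * 2^-1 ^+ (m %/ tau).
Proof.
move=> tau0 mn.
pose phi r : R := (2 * tau%:R - (r %% tau)%:R) * 2^-1 ^+ (r %/ tau).
have phiS r : 2^-1 ^+ (r %/ tau) = - (phi r.+1 - phi r).
  have lt := ltn_pmod r tau0; rewrite /phi.
  have [eq|ne] := eqVneq (r %% tau).+1 tau.
    have -> : (r.+1 %/ tau = (r %/ tau).+1)%N.
      by rewrite {1}(divn_eq r tau) -addnS eq -mulSnr mulnK//.
    have -> : (r.+1 %% tau = 0)%N.
      by rewrite {1}(divn_eq r tau) -addnS eq -mulSnr modnMl.
    have -> : tau%:R = (r %% tau)%:R + 1 :> R by rewrite natr1 eq.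
    by rewrite exprS; field.
  have lt' : ((r %% tau).+1 < tau)%N by rewrite ltn_neqAle ne.
  have -> : (r.+1 %/ tau = r %/ tau)%N.
    rewrite {1}(divn_eq r tau) -addnS divnMDl//.
    by rewrite [((_ %% _).+1 %/ _)%N]divn_small// addn0.
  have -> : (r.+1 %% tau = (r %% tau).+1)%N.
    by rewrite {1}(divn_eq r tau) -addnS modnMDl modn_small.
  by rewrite -natr1; ring.
under eq_bigr do rewrite phiS.
rewrite sumrN telescope_sumr// opprB lerBlDr.
have half_ge0 k : 0 <= (2^-1 : R) ^+ k by rewrite exprn_ge0 ?invr_ge0.
rewrite ler_wpDr ?ler_wpM2r ?gerBl//.
rewrite mulr_ge0// subr_ge0 -natrM ler_nat.
by rewrite (leq_trans (ltnW (ltn_pmod n tau0)))// leq_pmull.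
Qed.

(** Turns bounds for a random initial state into bounds for a fixed one. It is kept transparent so
    that its mass unfolds to the indicator in [sum_eqM]. *)
Definition dirac_distr (R : realType) (I : finType) (x : I) : distr R I.
Proof.
exists (fun y => (y == x)%:R); first by move=> y; case: eqP.
by under eq_bigr do rewrite -[_%:R]mulr1; rewrite (sum_eqM x (fun=> 1)).
Defined.

(** * Splitting off the first entry of a finite sequence *)

Definition cons_ffun (X : Type) (n : nat) (x : X) (w : {ffun 'I_n -> X}) :
  {ffun 'I_n.+1 -> X} := [ffun i => oapp w x (unlift ord0 i)].

Lemma cons_ffun0 (X : Type) (n : nat) (x : X) (w : {ffun 'I_n -> X}) :
  cons_ffun x w ord0 = x.
Proof. by rewrite ffunE unlift_none. Qed.

Lemma cons_ffun_lift (X : Type) (n : nat) (x : X) (w : {ffun 'I_n -> X}) i :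
  cons_ffun x w (lift ord0 i) = w i.
Proof. by rewrite ffunE liftK. Qed.

Lemma sum_ffun_recl (V : nmodType) (X : finType) (n : nat)
    (F : {ffun 'I_n.+1 -> X} -> V) :
  \sum_w F w = \sum_x \sum_w F (cons_ffun x w).
Proof.
pose uncons (w : {ffun 'I_n.+1 -> X}) := (w ord0, [ffun i => w (lift ord0 i)]).
rewrite pair_big/= (reindex (fun p => cons_ffun p.1 p.2))//=.
exists uncons => [[x w] _|w _] /=.
  congr pair; first by rewrite cons_ffun0.
  by apply/ffunP => i; rewrite ffunE cons_ffun_lift.
apply/ffunP => i; case: (unliftP ord0 i) => [j ->|->].
  by rewrite cons_ffun_lift ffunE.
by rewrite cons_ffun0.
Qed.

(** * Expectations along trajectories as iterates of a one-step operator *)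

Section Chain.
Context {R : realType} {S A : finType}.
Variables (M : mdp R S A) (pi : policy R S A).

Implicit Types (h : S * A -> R) (x : S * A) (s : S) (q nu : distr R S).

Definition policy_avg h s : R := \sum_a pi s a * h (s, a).

(** The transition operator of the Markov chain of state-action pairs. Its iterates replace every
    sum over trajectories below. *)
Definition next_avg h x : R :=
  \sum_s trans M x.1 x.2 s * policy_avg h s.

Lemma next_avgE h x :
  next_avg h x = \sum_y trans M x.1 x.2 y.1 * pi y.1 y.2 * h y.
Proof.
rewrite /next_avg.
under eq_bigr do rewrite /policy_avg mulr_sumr.
rewrite pair_big/=; apply: eq_bigr => -[s a] _ /=.
by rewrite mulrA.
Qed.

Lemma policy_avg_cst (b : R) s : policy_avg (fun=> b) s = b.
Proof. by rewrite /policy_avg -mulr_suml mass_sum1 mul1r. Qed.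

Lemma next_avg_cst (b : R) x : next_avg (fun=> b) x = b.
Proof.
rewrite /next_avg; under eq_bigr do rewrite policy_avg_cst.
by rewrite -mulr_suml mass_sum1 mul1r.
Qed.

Lemma path_prob_cons n x (w : traj S A n) :
  path_prob M pi (cons_ffun x w : traj S A n.+1) =
  trans M x.1 x.2 (w ord0).1 * pi (w ord0).1 (w ord0).2 * path_prob M pi w.
Proof.
rewrite /path_prob big_ord_recl /=; congr (_ * _).
  rewrite cons_ffun_lift (_ : widen_ord _ _ = ord0) ?cons_ffun0//.
  exact: val_inj.
apply: eq_bigr => i _; rewrite cons_ffun_lift.
rewrite (_ : widen_ord _ _ = lift ord0 (widen_ord (leqnSn n) i)).
  by rewrite cons_ffun_lift.
exact: val_inj.
Qed.

(** The Markov property: once the prescribed first pair is split off, the rest is a trajectory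
    started from a random pair [y], drawn from the one-step law at [x]. *)
Lemma sum_traj_recl n x (G : traj S A n.+1 -> R) :
  \sum_(w : traj S A n.+1) (w ord0 == x)%:R * path_prob M pi w * G w =
  \sum_y trans M x.1 x.2 y.1 * pi y.1 y.2 *
    \sum_(w : traj S A n) (w ord0 == y)%:R * path_prob M pi w *
      G (cons_ffun x w).
Proof.
rewrite sum_ffun_recl.
transitivity (\sum_x' (x' == x)%:R * \sum_(w : traj S A n)
   path_prob M pi (cons_ffun x' w : traj S A n.+1) * G (cons_ffun x' w)).
  apply: eq_bigr => x' _; rewrite mulr_sumr; apply: eq_bigr => w _.
  by rewrite cons_ffun0 mulrA.
rewrite sum_eqM.
under [RHS]eq_bigr do rewrite mulr_sumr.
rewrite exchange_big/=; apply: eq_bigr => w _.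
(* An indicator is inserted to name the first pair of the tail, which becomes the start [y]. *)
rewrite path_prob_cons -[LHS](sum_eqM (w ord0)
  (fun y => trans M x.1 x.2 y.1 * pi y.1 y.2 * path_prob M pi w *
     G (cons_ffun x w))).
by apply: eq_bigr => y _; rewrite eq_sym; ring.
Qed.

Lemma sum_traj_prob n x :
  \sum_(w : traj S A n) (w ord0 == x)%:R * path_prob M pi w = 1.
Proof.
elim: n x => [|n IHn] x.
  rewrite sum_ffun_recl.
  under eq_bigr do under eq_bigr do
    rewrite cons_ffun0 /path_prob big_ord0 mulr1.
  under eq_bigr do rewrite sumr_const card_ffun card_ord expn0 -[_ *+ 1]mulr1.
  by rewrite (sum_eqM x (fun=> 1)).
transitivity (\sum_(w : traj S A n.+1)
    (w ord0 == x)%:R * path_prob M pi w * 1).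
  by apply: eq_bigr => w _; rewrite mulr1.
(* The right-hand 1 is written as a one-step average of 1, to be compared term by term. *)
rewrite sum_traj_recl -[RHS](next_avg_cst 1 x) next_avgE.
apply: eq_bigr => y _; congr (_ * _).
by under eq_bigr do rewrite mulr1; exact: IHn.
Qed.

Lemma sum_traj_at0 n h x :
  \sum_(w : traj S A n) (w ord0 == x)%:R * path_prob M pi w * h (w ord0) = h x.
Proof.
rewrite -[RHS]mulr1 -[in RHS](sum_traj_prob n x) mulr_sumr.
apply: eq_bigr => w _.
have [->|_] := eqVneq (w ord0) x; first by rewrite mulrC.
by rewrite !mul0r mulr0.
Qed.

(** Induction on the horizon: each pair split off lowers [t] by one and contributes one application
    of [next_avg], until [t] is 0. *)
Lemma sum_traj_at n (t : 'I_n.+1) h x :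
  \sum_(w : traj S A n) (w ord0 == x)%:R * path_prob M pi w * h (w t) =
  iter t next_avg h x.
Proof.
elim: n t x => [|n IHn] t x; case: (unliftP ord0 t) => [j ->|->] /=.
- by case: j.
- exact: sum_traj_at0.
- rewrite sum_traj_recl next_avgE; apply: eq_bigr => y _; congr (_ * _).
  by rewrite -IHn; apply: eq_bigr => w _; rewrite cons_ffun_lift.
- exact: sum_traj_at0.
Qed.

Lemma sum_traj_from_pair n (t : 'I_n.+1) h s a :
  \sum_(w : traj S A n) traj_prob_from_pair M pi s a w * h (w t) =
  iter t next_avg h (s, a).
Proof. exact: sum_traj_at. Qed.

Lemma sum_traj_prob_from_pair n s a :
  \sum_(w : traj S A n) traj_prob_from_pair M pi s a w = 1.
Proof. exact: sum_traj_prob. Qed.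

(** The law started from [s] is the mixture, with weights [pi s a], of the laws started from the
    pairs [(s, a)]. *)
Lemma sum_traj_from_state n (t : 'I_n.+1) h s :
  \sum_(w : traj S A n) traj_prob_from_state M pi s w * h (w t) =
  policy_avg (iter t next_avg h) s.
Proof.
rewrite /policy_avg; under [RHS]eq_bigr do rewrite -sum_traj_at mulr_sumr.
rewrite exchange_big/=; apply: eq_bigr => w _; rewrite /traj_prob_from_state.
case: (w ord0) => s' a' /=; have [->|ne] := eqVneq s' s; last first.
  rewrite !mul0r big1// => a _.
  by rewrite xpair_eqE (negbTE ne) !mul0r mulr0.
rewrite -[LHS](sum_eqM a' (fun a => 1 * pi s a * path_prob M pi w * h (w t))).
by apply: eq_bigr => a _; rewrite xpair_eqE eqxx/= eq_sym; ring.
Qed.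

Lemma sum_traj_prob_from_state n s :
  \sum_(w : traj S A n) traj_prob_from_state M pi s w = 1.
Proof.
have := sum_traj_from_state (@ord0 n) (fun=> 1) s.
rewrite policy_avg_cst => <-.
by apply: eq_bigr => w _; rewrite mulr1.
Qed.

(** Linearity of expectation; [rho] comes out unchanged because the trajectory law has total mass
    1. *)
Lemma truncated_QE (rho : R) s a n :
  truncated_Q M pi rho s a n =
  \sum_(0 <= t < n.+1) (iter t next_avg (cost_at M) (s, a) - rho).
Proof.
rewrite /truncated_Q; under eq_bigr do rewrite mulr_sumr.
rewrite exchange_big/= big_mkord; apply: eq_bigr => t _.
rewrite -sum_traj_from_pair -[X in _ - X]mulr1.
rewrite -[X in _ - _ * X](sum_traj_prob_from_pair n s a).
rewrite mulr_sumr -sumrB; apply: eq_bigr => w _; ring.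
Qed.

(** * From the operator on pairs to the transition matrix on states *)

Definition policy_avg_col h : 'cV[R]_#|S| := \col_i policy_avg h (enum_val i).

(** Averaging over the action intertwines the two dynamics, so expected costs become powers of the
    matrix applied to one fixed column. *)
Lemma policy_avg_col_next h :
  policy_avg_col (next_avg h) = policy_mx M pi *m policy_avg_col h.
Proof.
apply/colP => i; rewrite !mxE.
under [RHS]eq_bigr do rewrite !mxE.
rewrite (sum_enum_val (fun s => (\sum_a pi (enum_val i) a *
   trans M (enum_val i) a s) * policy_avg h s)).
rewrite {1}/policy_avg; under eq_bigr do rewrite mulr_sumr.
rewrite exchange_big/=; apply: eq_bigr => s _.
by rewrite mulr_suml; apply: eq_bigr => a _; rewrite mulrA.
Qed.

Lemma policy_avg_col_iter t h :
  policy_avg_col (iter t next_avg h) = policy_mx M pi ^+ t *m policy_avg_col h.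
Proof.
elim: t => [|t IHt]; first by rewrite expr0 mul1mx.
by rewrite iterS policy_avg_col_next IHt mulmxA exprS.
Qed.

Lemma sum_distr_policy_avg q h :
  \sum_s q s * policy_avg h s = ((distr_col q)^T *m policy_avg_col h) 0 0.
Proof.
rewrite mxE -sum_enum_val; apply: eq_bigr => i _.
by rewrite !mxE.
Qed.

Lemma avg_costE nu : avg_cost M pi nu =
  ((distr_col nu)^T *m policy_avg_col (cost_at M)) 0 0.
Proof.
rewrite -sum_distr_policy_avg; apply: eq_bigr => s _.
by rewrite mulr_sumr; apply: eq_bigr => a _; rewrite mulrA.
Qed.

(** * Sup bounds, and the l1 norm under the transposed matrix *)

Lemma cost_at_le x : `|cost_at M x| <= cost_bound M.
Proof. exact: (@le_bigmax _ _ _ _ (fun x => `|cost_at M x|)). Qed.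

Lemma cost_bound_ge0 : 0 <= cost_bound M.
Proof. exact: bigmax_ge_id. Qed.

Lemma policy_avg_le h (b : R) s :
  (forall x, `|h x| <= b) -> `|policy_avg h s| <= b.
Proof.
move=> hb; rewrite -(policy_avg_cst b s) (le_trans (ler_norm_sum _ _ _))//.
apply: ler_sum => a _.
by rewrite normrM ger0_norm ?mass_ge0// ler_wpM2l ?mass_ge0.
Qed.

Lemma norm1_ge0 (v : 'cV[R]_#|S|) : 0 <= norm1 v.
Proof. exact: sumr_ge0. Qed.

(** Hölder's inequality for the pair l1, l-infinity. *)
Lemma dot_norm1_le (u v : 'cV[R]_#|S|) (b : R) :
  (forall i, `|v i 0| <= b) -> `|(u^T *m v) 0 0| <= b * norm1 u.
Proof.
move=> vb; rewrite mxE (le_trans (ler_norm_sum _ _ _))// mulr_sumr.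
apply: ler_sum => i _; rewrite mxE normrM mulrC.
by rewrite ler_wpM2r.
Qed.

Lemma policy_mx_ge0 i j : 0 <= policy_mx M pi i j.
Proof. by rewrite mxE sumr_ge0// => a _; rewrite mulr_ge0 ?mass_ge0. Qed.

Lemma policy_mx_row_sum i : \sum_j policy_mx M pi i j = 1.
Proof.
under eq_bigr do rewrite mxE.
rewrite (sum_enum_val (fun s => \sum_a pi (enum_val i) a *
   trans M (enum_val i) a s)) exchange_big/=.
rewrite -[RHS](mass_sum1 (pi (enum_val i))).
by apply: eq_bigr => a _; rewrite -mulr_sumr mass_sum1 mulr1.
Qed.

Lemma sum_policy_mx_tr (v : 'cV[R]_#|S|) :
  \sum_i ((policy_mx M pi)^T *m v) i 0 = \sum_i v i 0.
Proof.
under eq_bigr do rewrite mxE.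
rewrite exchange_big/=; apply: eq_bigr => j _.
under eq_bigr do rewrite mxE.
by rewrite -mulr_suml policy_mx_row_sum mul1r.
Qed.

(** Triangle inequality in each entry; after the sums are exchanged, each row of the stochastic
    matrix contributes 1. *)
Lemma norm1_policy_mx_tr (v : 'cV[R]_#|S|) :
  norm1 ((policy_mx M pi)^T *m v) <= norm1 v.
Proof.
rewrite /norm1.
apply: (@le_trans _ _ (\sum_i \sum_j policy_mx M pi j i * `|v j 0|)).
  apply: ler_sum => i _; rewrite mxE (le_trans (ler_norm_sum _ _ _))//.
  by apply: ler_sum => j _; rewrite mxE normrM ger0_norm ?policy_mx_ge0.
rewrite exchange_big/=; apply: ler_sum => j _.
by rewrite -mulr_suml policy_mx_row_sum mul1r.
Qed.

Lemma policy_mx_tr_expS t (v : 'cV[R]_#|S|) :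
  (policy_mx M pi ^+ t.+1)^T *m v =
  (policy_mx M pi)^T *m ((policy_mx M pi ^+ t)^T *m v).
Proof. by rewrite exprSr trmx_mul mulmxA. Qed.

Lemma policy_mx_tr_expD t u (v : 'cV[R]_#|S|) :
  (policy_mx M pi ^+ (t + u))^T *m v =
  (policy_mx M pi ^+ t)^T *m ((policy_mx M pi ^+ u)^T *m v).
Proof. by rewrite addnC exprD trmx_mul mulmxA. Qed.

Lemma sum_policy_mx_tr_exp t (v : 'cV[R]_#|S|) :
  \sum_i ((policy_mx M pi ^+ t)^T *m v) i 0 = \sum_i v i 0.
Proof.
elim: t => [|t IHt]; first by rewrite expr0 trmx1 mul1mx.
by rewrite policy_mx_tr_expS sum_policy_mx_tr.
Qed.

Lemma norm1_policy_mx_tr_exp t (v : 'cV[R]_#|S|) :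
  norm1 ((policy_mx M pi ^+ t)^T *m v) <= norm1 v.
Proof.
elim: t => [|t IHt]; first by rewrite expr0 trmx1 mul1mx.
by rewrite policy_mx_tr_expS (le_trans (norm1_policy_mx_tr _)).
Qed.

Lemma norm1Z (b : R) (v : 'cV[R]_#|S|) : norm1 (b *: v) = `|b| * norm1 v.
Proof.
by rewrite /norm1 mulr_sumr; apply: eq_bigr => i _; rewrite mxE normrM.
Qed.

Lemma norm1B (u v : 'cV[R]_#|S|) : norm1 (u - v) <= norm1 u + norm1 v.
Proof.
rewrite /norm1 -big_split/=; apply: ler_sum => i _.
by rewrite !mxE ler_normB.
Qed.

Lemma distr_col_sum q : \sum_i distr_col q i 0 = 1.
Proof.
under eq_bigr do rewrite mxE.
by rewrite (sum_enum_val q) mass_sum1.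
Qed.

Lemma distr_of_col (v : 'cV[R]_#|S|) :
  (forall i, 0 <= v i 0) -> \sum_i v i 0 = 1 -> exists q, distr_col q = v.
Proof.
move=> v0 v1.
have ge0 s : 0 <= v (enum_rank s) 0 by [].
have sum1 : \sum_s v (enum_rank s) 0 = 1.
  rewrite -v1 -sum_enum_val; apply: eq_bigr => i _.
  by rewrite enum_valK.
exists (Distr ge0 sum1); apply/colP => i.
by rewrite mxE/= enum_valK.
Qed.

(* The positive and negative parts of v have the same mass norm1 v / 2. *)
Lemma zero_sum_decomp (v : 'cV[R]_#|S|) : \sum_i v i 0 = 0 -> v != 0 ->
  exists q1 q2, v = (norm1 v / 2) *: (distr_col q1 - distr_col q2).
Proof.
move=> v0 nz; set m := norm1 v.
have m_gt0 : 0 < m.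
  rewrite lt_neqAle norm1_ge0 andbT eq_sym; apply: contra nz => /eqP m0.
  apply/eqP/colP => i; apply/eqP; rewrite mxE -normr_eq0; apply/eqP.
  move: m0; rewrite /m /norm1 => /eqP.
  by rewrite psumr_eq0// => /allP /(_ i (mem_index_enum i)) /eqP.
have [q1 e1] : exists q, distr_col q = \col_i ((`|v i 0| + v i 0) / m).
  apply: distr_of_col => [i|].
    rewrite mxE divr_ge0 ?(ltW m_gt0)//.
    by rewrite -lerBlDr sub0r (le_trans (ler_norm _))// normrN.
  under eq_bigr do rewrite mxE.
  by rewrite -mulr_suml big_split/= v0 addr0 -/(norm1 v) divff// gt_eqF.
have [q2 e2] : exists q, distr_col q = \col_i ((`|v i 0| - v i 0) / m).
  apply: distr_of_col => [i|].
    by rewrite mxE divr_ge0 ?(ltW m_gt0)// subr_ge0 ler_norm.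
  under eq_bigr do rewrite mxE.
  by rewrite -mulr_suml sumrB v0 subr0 -/(norm1 v) divff// gt_eqF.
exists q1, q2; rewrite e1 e2; apply/colP => i; rewrite !mxE.
by field; rewrite gt_eqF.
Qed.

(** * Geometric mixing and the tail of the bias series *)

Section Mixing.
Variables (nu : distr R S) (tau : nat).
Hypotheses (hnu : stationary M pi nu)
  (htau : forall q, norm1 ((policy_mx M pi ^+ tau)^T *m distr_col q
                             - distr_col nu) <= 2^-1).

(** Up to the factor [norm1 v / 2], [v] is a difference of two distributions. Both images lie within
    1/2 of [nu], hence within 1 of each other. *)
Lemma zero_sum_halved (v : 'cV[R]_#|S|) : \sum_i v i 0 = 0 ->
  norm1 ((policy_mx M pi ^+ tau)^T *m v) <= 2^-1 * norm1 v.
Proof.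
move=> v0; have [->|nz] := eqVneq v 0.
  by rewrite mulmx0 /norm1 big1 ?mulr0// => i _; rewrite mxE normr0.
have [q1 [q2 {1}->]] := zero_sum_decomp v0 nz.
rewrite -scalemxAr norm1Z ger0_norm ?divr_ge0 ?norm1_ge0//.
rewrite [leRHS]mulrC ler_piMr// ?divr_ge0 ?norm1_ge0//.
rewrite mulmxBr -(subrKA (distr_col nu)) -[distr_col nu - _]opprB.
by apply: (le_trans (norm1B _ _)); have := htau q1; have := htau q2; lra.
Qed.

Lemma stationary_exp t : (policy_mx M pi ^+ t)^T *m distr_col nu = distr_col nu.
Proof.
elim: t => [|t IHt]; first by rewrite expr0 trmx1 mul1mx.
by rewrite policy_mx_tr_expS IHt.
Qed.

(** After the first block the error has zero sum, and [nu] is fixed, so each further block halves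
    it. The count starts at one block because the initial l1 distance can exceed 1. *)
Lemma norm1_mixing_mul q k :
  norm1 ((policy_mx M pi ^+ (k.+1 * tau))^T *m distr_col q - distr_col nu)
    <= 2^-1 ^+ k.+1.
Proof.
elim: k => [|k IHk]; first by rewrite mul1n expr1.
rewrite mulSn policy_mx_tr_expD -[X in _ - X](stationary_exp tau) -mulmxBr.
apply: le_trans (zero_sum_halved _) _.
  under eq_bigr do rewrite mxE [X in _ + X]mxE.
  by rewrite sumrB sum_policy_mx_tr_exp !distr_col_sum subrr.
by rewrite exprS ler_wpM2l ?invr_ge0.
Qed.

(** The [t %% tau] steps left over after the full blocks cannot increase the l1 distance. *)
Lemma norm1_mixing q t : (tau <= t)%N -> (0 < tau)%N ->
  norm1 ((policy_mx M pi ^+ t)^T *m distr_col q - distr_col nu)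
    <= 2^-1 ^+ (t %/ tau).
Proof.
move=> taut tau0; have : (0 < t %/ tau)%N by rewrite divn_gt0.
rewrite [X in _ ^+ X](divn_eq t tau); case: (t %/ tau)%N => // k _.
rewrite addnC policy_mx_tr_expD.
rewrite -[X in _ - X](stationary_exp (t %% tau)) -mulmxBr.
exact: le_trans (norm1_policy_mx_tr_exp _ _) (norm1_mixing_mul _ _).
Qed.

Hypotheses (tau_gt0 : (0 < tau)%N).

Lemma expected_cost_mixing q t : (tau <= t)%N ->
  `|\sum_s q s * policy_avg (iter t next_avg (cost_at M)) s - avg_cost M pi nu|
    <= cost_bound M * 2^-1 ^+ (t %/ tau).
Proof.
move=> taut; rewrite sum_distr_policy_avg policy_avg_col_iter mulmxA.
(* The matrix power moves from the cost column to the law, where it acts transposed. *)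
rewrite -[X in X *m _]trmxK trmx_mul trmxK avg_costE.
set u := _ *m distr_col q; set v := policy_avg_col _.
have -> : (u^T *m v) 0 0 - ((distr_col nu)^T *m v) 0 0 =
          ((u - distr_col nu)^T *m v) 0 0 by rewrite linearB/= mulmxBl !mxE.
have vb i : `|v i 0| <= cost_bound M.
  by rewrite mxE; apply: policy_avg_le; exact: cost_at_le.
apply: le_trans (dot_norm1_le _ vb) _.
by rewrite ler_wpM2l ?cost_bound_ge0// norm1_mixing.
Qed.

Lemma policy_avg_cost_mixing s t : (tau <= t)%N ->
  `|policy_avg (iter t next_avg (cost_at M)) s - avg_cost M pi nu|
    <= cost_bound M * 2^-1 ^+ (t %/ tau).
Proof.
by move=> /(expected_cost_mixing (dirac_distr R s)); rewrite sum_eqM.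
Qed.

Definition bias_term x t : R :=
  iter t next_avg (cost_at M) x - avg_cost M pi nu.

(** The first step leads to the state law [trans M x.1 x.2], and the policy governs the [t]
    remaining ones; this is the previous estimate with that law as [q]. *)
Lemma bias_term_mixing x t : (tau <= t)%N ->
  `|bias_term x t.+1| <= cost_bound M * 2^-1 ^+ (t %/ tau).
Proof. exact: expected_cost_mixing. Qed.

Lemma bias_tail_le x m n : (tau <= m <= n)%N ->
  \sum_(m.+1 <= t < n.+1) `|bias_term x t|
    <= 2 * cost_bound M * tau%:R * 2^-1 ^+ (m %/ tau).
Proof.
move=> /andP[taum mn]; rewrite big_add1/=.
apply: (@le_trans _ _ (\sum_(m <= t < n) cost_bound M * 2^-1 ^+ (t %/ tau))).
  apply: ler_sum_nat => t /andP[mt _].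
  by rewrite bias_term_mixing// (leq_trans taum).
rewrite -mulr_sumr -[2 * _]mulrC -!mulrA ler_wpM2l ?cost_bound_ge0// mulrA.
exact: sum_half_div_le.
Qed.

Lemma truncated_Q_series s a n :
  truncated_Q M pi (avg_cost M pi nu) s a n = series (bias_term (s, a)) n.+1.
Proof. by rewrite truncated_QE. Qed.

Lemma truncated_Q_tail_le s a m n : (tau <= m <= n)%N ->
  `|truncated_Q M pi (avg_cost M pi nu) s a n
    - truncated_Q M pi (avg_cost M pi nu) s a m|
    <= 2 * cost_bound M * tau%:R * 2^-1 ^+ (m %/ tau).
Proof.
move=> /[dup] taumn /andP[_ mn]; rewrite !truncated_Q_series.
rewrite sub_series_geq ?ltnS// (le_trans (ler_norm_sum _ _ _))//.
exact: bias_tail_le.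
Qed.

(** Absolute convergence; it makes the [limn] in [bias_Q] a genuine limit instead of a default
    value. *)
Lemma is_cvg_truncated_Q s a :
  cvgn (truncated_Q M pi (avg_cost M pi nu) s a).
Proof.
rewrite (_ : truncated_Q _ _ _ _ _ =
             fun n => series (bias_term (s, a)) n.+1); last first.
  by apply/funext => n; exact: truncated_Q_series.
suff /cvg_ex[l ul] : cvgn (series (bias_term (s, a))).
  by apply/cvg_ex; exists l; rewrite cvg_shiftS.
apply: normed_cvg.
apply: nondecreasing_is_cvgn.
  by apply: nondecreasing_series => n _ _; exact: normr_ge0.
(* Mixing controls only the terms of index above [tau]; the earlier ones enter the bound as they
   are. *)
exists (\sum_(0 <= t < tau.+1) `|bias_term (s, a) t| +
        2 * cost_bound M * tau%:R * 2^-1 ^+ (tau %/ tau)).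
move=> _ [n _ <-]; rewrite /series/=.
(* Extending the sum up to [maxn tau n] allows the cut at [tau.+1] for every [n]. *)
apply: (@le_trans _ _ (\sum_(0 <= t < (maxn tau n).+1) `|bias_term (s, a) t|)).
  by apply: (@nondecreasing_series _ _ xpredT) => //;
     exact: leqW (leq_maxr _ _).
rewrite (big_cat_nat (n := tau.+1)) ?ltnS ?leq_maxl//= lerD2l.
by apply: bias_tail_le; rewrite leqnn leq_maxl.
Qed.

(** The tail estimate is uniform in [n], so it survives the limit in [n] with [m] fixed. *)
Lemma truncated_Q_bias_le s a m : (tau <= m)%N ->
  `|truncated_Q M pi (avg_cost M pi nu) s a m - bias_Q M pi nu s a|
    <= 2 * cost_bound M * tau%:R * 2^-1 ^+ (m %/ tau).
Proof.
move=> taum; set b := 2 * _ * _ * _; set u := truncated_Q _ _ _ _ _.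
have near_b : \forall n \near \oo, `|u n - u m| <= b.
  by exists m => // n /= mn; apply: truncated_Q_tail_le; rewrite taum.
have cu : cvgn u by exact: is_cvg_truncated_Q.
have le_lim : bias_Q M pi nu s a <= u m + b.
  apply: limr_le => //; rewrite -/u; apply: filterS near_b => n.
  by rewrite -/(u n) ler_norml; lra.
have ge_lim : u m - b <= bias_Q M pi nu s a.
  apply: limr_ge => //; apply: filterS near_b => n.
  by rewrite -/(u n) ler_norml; lra.
by rewrite ler_norml; apply/andP; split; lra.
Qed.

End Mixing.
End Chain.

(** * Product laws on finite types, and expectations of finitely valued variables *)

Section Product.
Context {R : comNzRingType} {I J : finType}.
Variables (p : I -> J -> R).
Hypothesis p1 : forall i, \sum_j p i j = 1.

Lemma sum_prod_ffun : \sum_(x : {ffun I -> J}) \prod_i p i (x i) = 1.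
Proof. by rewrite -bigA_distr_bigA big1. Qed.

(** Absorb [g] into the factor of index [k] and distribute the product over the sums; the other
    factors sum to 1. *)
Lemma sum_prod_ffun_marginal (k : I) (g : J -> R) :
  \sum_(x : {ffun I -> J}) (\prod_i p i (x i)) * g (x k) =
  \sum_j p k j * g j.
Proof.
transitivity (\sum_(x : {ffun I -> J})
    \prod_i (p i (x i) * (if i == k then g (x i) else 1))).
  apply: eq_bigr => x _; rewrite big_split/=; congr (_ * _).
  rewrite (bigD1 k)//= eqxx big1 ?mulr1// => i /negbTE ->//.
rewrite -(bigA_distr_bigA (fun i j => p i j * (if i == k then g j else 1))).
rewrite (bigD1 k)//= eqxx [X in _ * X]big1 ?mulr1// => i /negbTE ->.
by under eq_bigr do rewrite mulr1.
Qed.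

End Product.

(** The integrand is a finite combination of indicators of the fibres of [Z], each of them
    integrable. *)
Lemma expectation_finType d (Omega : measurableType d) (R : realType)
    (P : probability Omega R) (F : finType) (Z : Omega -> F) (p f : F -> R) :
  (forall z, measurable (Z @^-1` [set z])) ->
  (forall z, P (Z @^-1` [set z]) = (p z)%:E) ->
  ('E_P[fun w => f (Z w)] = (\sum_z p z * f z)%:E)%E.
Proof.
move=> mZ pZ; rewrite unlock.
transitivity (\int[P]_w (\sum_z (f z)%:E * (\1_(Z @^-1` [set z]) w)%:E))%E.
  apply: eq_integral => w _; rewrite (bigD1 (Z w))//= big1 ?adde0.
    by rewrite indicE mem_set// mule1.
  by move=> z zne; rewrite indicE memNset ?mule0//= => e; rewrite e eqxx in zne.
have intI z : P.-integrable setT (EFin \o \1_(Z @^-1` [set z])).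
  exact: integrable_indic.
rewrite integral_sum//; last first.
  by move=> z; apply: (integrableZl _ (f z) (intI z)).
rewrite -sumEFin; apply: eq_bigr => z _.
by rewrite (integralZl _ (intI z))// integral_indic// setIT EFinM muleC -pZ.
Qed.

(** * Means of the two estimators *)

Section Samples.
Context {R : realType} {S A : finType} {d : measure_display}
  {Omega : measurableType d}.
Variables (M : mdp R S A) (pi : policy R S A) (T T' N N' : nat)
  (P : probability Omega R) (start : 'I_N -> S)
  (X : 'I_N -> Omega -> traj S A T)
  (Y : 'I_N' -> S -> A -> Omega -> traj S A T').
Hypotheses (hXY : generated_samples M X Y pi P start)
  (N_gt0 : (0 < N)%N) (N'_gt0 : (0 < N')%N).

(** The second batch is indexed by triples, so that its law is a product over a single finite
    type. *)
Let samples : finType :=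
  ({ffun 'I_N -> traj S A T} * {ffun 'I_N' * (S * A) -> traj S A T'})%type.

Let Z (w : Omega) : samples :=
  ([ffun i => X i w], [ffun k => Y k.1 k.2.1 k.2.2 w]).

Let lawX (i : 'I_N) : traj S A T -> R :=
  traj_prob_from_state M pi (start i).

Let lawX1 i : \sum_w lawX i w = 1.
Proof. exact: sum_traj_prob_from_state. Qed.

Let lawY (k : 'I_N' * (S * A)) : traj S A T' -> R :=
  traj_prob_from_pair M pi k.2.1 k.2.2.

Let lawY1 k : \sum_w lawY k w = 1.
Proof. exact: sum_traj_prob_from_pair. Qed.

Let pX (x : {ffun 'I_N -> traj S A T}) : R := \prod_i lawX i (x i).

Let pY (y : {ffun 'I_N' * (S * A) -> traj S A T'}) : R :=
  \prod_k lawY k (y k).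

Let Z_fiber z : Z @^-1` [set z] =
  [set w | (forall i, X i w = z.1 i) /\
           (forall j s a, Y j s a w = z.2 (j, (s, a)))].
Proof.
case: z => x y; apply/seteqP; split => w /=.
  by case=> <- <-; split => *; rewrite ffunE.
case=> ex ey; congr pair; apply/ffunP => k; rewrite ffunE//.
by rewrite ey; case: k => ? [].
Qed.

Let measurable_fiber z : measurable (Z @^-1` [set z]).
Proof.
have [mX mY _] := hXY.
rewrite (_ : _ @^-1` _ =
    (\bigcap_(i in [set: 'I_N]) (X i @^-1` [set z.1 i])) `&`
    (\bigcap_(k in [set: 'I_N' * (S * A)])
        (Y k.1 k.2.1 k.2.2 @^-1` [set z.2 k]))); last first.
  rewrite Z_fiber; apply/seteqP; split => w /= [hx hy]; split.
  - by move=> i _; exact: hx.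
  - by case=> j [s a] _; exact: hy.
  - by move=> i; exact: hx.
  - by move=> j s a; exact: (hy (j, (s, a))).
by apply: measurableI; apply: fin_bigcap_measurable => //; exact: finite_finset.
Qed.

Let expectation_samples (f : samples -> R) :
  ('E_P[fun w => f (Z w)] = (\sum_x \sum_y pX x * pY y * f (x, y))%:E)%E.
Proof.
rewrite (expectation_finType (p := fun z => pX z.1 * pY z.2))//.
  by rewrite pair_big/=; congr (_%:E); apply: eq_bigr => -[].
move=> z; rewrite Z_fiber.
have [_ _ /(_ z.1 (fun j s a => z.2 (j, (s, a)))) ->] := hXY.
congr (_ * _)%:E; rewrite /pY.
transitivity (\prod_j \prod_(x : S * A)
    traj_prob_from_pair M pi x.1 x.2 (z.2 (j, x))).
  by apply: eq_bigr => j _; rewrite pair_big/=; apply: eq_bigr => -[].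
by rewrite pair_big/=; apply: eq_bigr => -[].
Qed.

Let sum_pX : \sum_x pX x = 1.
Proof. by apply: sum_prod_ffun => i; exact: lawX1. Qed.

Let sum_pX_at i (g : traj S A T -> R) :
  \sum_x pX x * g (x i) = \sum_w lawX i w * g w.
Proof. by apply: sum_prod_ffun_marginal => k; exact: lawX1. Qed.

Let sum_pY : \sum_y pY y = 1.
Proof. by apply: sum_prod_ffun => k; exact: lawY1. Qed.

Let sum_pY_at k (g : traj S A T' -> R) :
  \sum_y pY y * g (y k) = \sum_w lawY k w * g w.
Proof. by apply: sum_prod_ffun_marginal => i; exact: lawY1. Qed.

Definition mean_rho_hat : R :=
  N%:R^-1 * \sum_(i < N)
    policy_avg pi (iter T (next_avg M pi) (cost_at M)) (start i).

Let rho_of (x : {ffun 'I_N -> traj S A T}) : R :=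
  N%:R^-1 * \sum_(i < N) cost_at M (x i ord_max).

Let sum_rho_of : \sum_x pX x * rho_of x = mean_rho_hat.
Proof.
under eq_bigr do rewrite mulrCA mulr_sumr.
rewrite -mulr_sumr exchange_big/=; congr (_ * _); apply: eq_bigr => i _.
rewrite (sum_pX_at i (fun w : traj S A T => cost_at M (w ord_max))).
exact: (sum_traj_from_state M pi (@ord_max T)).
Qed.

Lemma expectation_rho_hat : ('E_P[rho_hat M X] = mean_rho_hat%:E)%E.
Proof.
rewrite -sum_rho_of -[LHS](_ : 'E_P[fun w => rho_of (Z w).1] = _)%E.
  rewrite (expectation_samples (fun z => rho_of z.1))/=.
  congr (_%:E); apply: eq_bigr => x _.
  rewrite -[RHS]mulr1 -[in RHS]sum_pY mulr_sumr.
  by apply: eq_bigr => y _; rewrite mulrAC.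
congr (expectation P _); apply/funext => w; rewrite /rho_of /rho_hat.
by congr (_ * _); apply: eq_bigr => i _; rewrite ffunE.
Qed.

(** [rho_hat] enters each sample linearly, so only its mean matters; all the [N'] samples then have
    the same mean. *)
Lemma expectation_Q_hat s a :
  ('E_P[Q_hat M X Y s a] = (truncated_Q M pi mean_rho_hat s a T')%:E)%E.
Proof.
pose f (z : samples) := N'%:R^-1 * \sum_(j < N')
  \sum_(t < T'.+1) (cost_at M (z.2 (j, (s, a)) t) - rho_of z.1).
rewrite -[LHS](_ : 'E_P[fun w => f (Z w)] = _)%E; last first.
  congr (expectation P _); apply/funext => w; rewrite /f /Q_hat.
  congr (_ * _); apply: eq_bigr => j _; apply: eq_bigr => t _.
  rewrite ffunE; congr (_ - _); rewrite /rho_of /rho_hat.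
  by congr (_ * _); apply: eq_bigr => i _; rewrite ffunE.
rewrite expectation_samples; congr (_%:E).
have sumj j : \sum_x \sum_y pX x * pY y *
    (\sum_(t < T'.+1) (cost_at M (y (j, (s, a)) t) - rho_of x)) =
    truncated_Q M pi mean_rho_hat s a T'.
  rewrite truncated_QE big_mkord.
  under eq_bigr do under eq_bigr do rewrite mulr_sumr.
  under eq_bigr do rewrite exchange_big/=.
  rewrite exchange_big/=; apply: eq_bigr => t _.
  (* The cost depends on [y] alone and the estimated level on [x] alone, so each double sum
     factors. *)
  transitivity (\sum_x (pX x * (\sum_y pY y * cost_at M (y (j, (s, a)) t))
                        - pX x * rho_of x * \sum_y pY y)).
    apply: eq_bigr => x _; rewrite !mulr_sumr -sumrB; apply: eq_bigr => y _.
    by ring.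
  rewrite sumrB -!mulr_suml sum_pX sum_pY sum_rho_of mul1r mulr1; congr (_ - _).
  rewrite (sum_pY_at (j, (s, a)) (fun w : traj S A T' => cost_at M (w t))).
  exact: sum_traj_from_pair.
transitivity (N'%:R^-1 * \sum_(j < N') truncated_Q M pi mean_rho_hat s a T').
  under [in RHS]eq_bigr => j _ do rewrite -(sumj j).
  rewrite [in RHS]exchange_big/= mulr_sumr; apply: eq_bigr => x _.
  rewrite [in RHS]exchange_big/= mulr_sumr; apply: eq_bigr => y _.
  by rewrite /f mulrCA -mulr_sumr.
by rewrite sumr_const card_ord -[X in _ * X]mulr_natl mulKf// pnatr_eq0 -lt0n.
Qed.

(** The mixing bound is uniform in the initial state, so it passes to the average over arbitrary
    [start i]. *)
Lemma mean_rho_hat_mixing (nu : distr R S) (tau : nat) :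
  stationary M pi nu ->
  (forall q, norm1 ((policy_mx M pi ^+ tau)^T *m distr_col q - distr_col nu)
               <= 2^-1) ->
  (0 < tau <= T)%N ->
  `|mean_rho_hat - avg_cost M pi nu| <= cost_bound M * 2^-1 ^+ (T %/ tau).
Proof.
move=> hnu htau /andP[tau_gt0 tauT]; set b := cost_bound M * _.
have N_neq0 : N%:R != 0 :> R by rewrite pnatr_eq0 -lt0n.
have -> : mean_rho_hat - avg_cost M pi nu = N%:R^-1 * \sum_(i < N)
    (policy_avg pi (iter T (next_avg M pi) (cost_at M)) (start i)
     - avg_cost M pi nu).
  rewrite sumrB sumr_const card_ord -(mulr_natl (avg_cost _ _ _)).
  by rewrite mulrBr mulKf.
rewrite normrM normfV normr_nat ler_pdivrMl ?ltr0n//.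
rewrite (le_trans (ler_norm_sum _ _ _))//.
apply: (@le_trans _ _ (\sum_(i < N) b)); last first.
  by rewrite sumr_const card_ord -(mulr_natl b).
by apply: ler_sum => i _; exact: policy_avg_cost_mixing.
Qed.

End Samples.

(** * Change of level, the common mixing time, and the final bounds *)

Lemma truncated_QB (R : realType) (S A : finType) (M : mdp R S A)
    (pi : policy R S A) (rho rho' : R) s a n :
  truncated_Q M pi rho s a n =
  truncated_Q M pi rho' s a n - n.+1%:R * (rho - rho').
Proof.
rewrite !truncated_QE !sumrB !sumr_const_nat subn0.
by rewrite -(mulr_natl rho) -(mulr_natl rho'); ring.
Qed.

(** The mixing time [u] of [pi] itself may be smaller than [tmix]. As [u <= tmix], at least one full
    block of length [u] fits, which gives the factor 1/2. *)
Lemma tmix_norm1_le (R : realType) (S A : finType) (M : mdp R S A)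
    (nu : policy R S A -> distr R S) (tmix : nat) (pi : policy R S A)
    (q : distr R S) :
  stationary M pi (nu pi) -> is_tmix M nu tmix ->
  norm1 ((policy_mx M pi ^+ tmix)^T *m distr_col q - distr_col (nu pi))
    <= 2^-1.
Proof.
move=> hnu [/(_ pi)[u [[u_gt0 mix_u] _] u_le] _].
have hu q' : norm1 ((policy_mx M pi ^+ u)^T *m distr_col q' -
                    distr_col (nu pi)) <= 2^-1.
  rewrite -lee_fin; apply: le_trans mix_u.
  by apply: ereal_sup_ubound; exists q'.
apply: le_trans (norm1_mixing hnu hu q u_le u_gt0) _.
have : (0 < tmix %/ u)%N by rewrite divn_gt0.
case: (tmix %/ u)%N => // k _.
by rewrite exprS ler_piMr ?exprn_ile1 ?invr_ge0 ?invf_le1// ler1n.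
Qed.

Theorem proposition1 (R : realType) (S A : finType) (M : mdp R S A)
    (nu : policy R S A -> distr R S)
    (hnu : forall mu : policy R S A, stationary M mu (nu mu))
    (tmix : nat) (htmix : is_tmix M nu tmix)
    (pi : policy R S A) (T T' N N' : nat)
    (hT : (tmix + 1 < T)%N) (hT' : (tmix + 1 < T')%N)
    (hN : (0 < N)%N) (hN' : (0 < N')%N)
    (d : measure_display) (Omega : measurableType d) (P : probability Omega R)
    (start : 'I_N -> S)
    (X : 'I_N -> Omega -> traj S A T)
    (Y : 'I_N' -> S -> A -> Omega -> traj S A T')
    (hXY : generated_samples M X Y pi P start) :
  (`|'E_P[rho_hat M X] - (avg_cost M pi (nu pi))%:E|
     <= (cost_bound M * 2^-1 ^+ (T %/ tmix))%:E)%E /\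
  (norm_sup (fun s a => 'E_P[Q_hat M X Y s a] - (bias_Q M pi (nu pi) s a)%:E)
     <= (cost_bound M * T'.+1%:R * 2^-1 ^+ (T %/ tmix)
         + 2 * cost_bound M * tmix%:R * 2^-1 ^+ (T' %/ tmix))%:E)%E.
Proof.
have mix q := tmix_norm1_le q (hnu pi) htmix.
have tmix_gt0 : (0 < tmix)%N.
  have [/(_ pi)[u [[u_gt0 _] _] u_le] _] := htmix; exact: leq_trans u_le.
have tmix_le n : (tmix + 1 < n)%N -> (tmix <= n)%N.
  by move=> h; rewrite (leq_trans _ (ltnW h))// addn1 leqnSn.
have rho_le : `|mean_rho_hat M pi T start - avg_cost M pi (nu pi)|
    <= cost_bound M * 2^-1 ^+ (T %/ tmix).
  by apply: mean_rho_hat_mixing; rewrite ?tmix_gt0 ?tmix_le.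
split; first by rewrite (expectation_rho_hat hXY) -EFinB lee_fin.
(* The maximum in [norm_sup] starts from 0, so the bound must also be shown nonnegative. *)
apply: bigmax_le => [|[s a] _] /=.
  by rewrite lee_fin addr_ge0 ?mulr_ge0 ?cost_bound_ge0 ?exprn_ge0 ?invr_ge0.
rewrite (expectation_Q_hat hXY)// -EFinB lee_fin.
have Q_le := truncated_Q_bias_le (hnu pi) mix tmix_gt0 s a (tmix_le _ hT').
(* Moving the level to the true average cost splits the error into [T'.+1] times the bias of
   [rho_hat] and the truncation error. *)
rewrite (truncated_QB _ _ _ (avg_cost M pi (nu pi))) addrAC addrC.
apply: le_trans (ler_normD _ _) (lerD _ Q_le).
by rewrite normrN normrM normr_nat [leRHS]mulrAC [leRHS]mulrC ler_wpM2l.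
Qed.
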